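(* Suppose $S = \langle a_1, a_2, a_3\rangle$ is a numerical semigroup with exactly three minimal generators $a_1 < a_2 < a_3$. If $S$ has at most $1$ expression as a gluing, then $\Delta_0(S) = \{1,2\}$. Otherwise, $\Delta_0(S) = \{1\}$.
   Context: A numerical semigroup is a cofinite, additively closed subset $S \subseteq \mathbb{Z}_{\ge 0}$ containing $0$; $\langle b_1,\ldots,b_n\rangle$ denotes the set of all $\mathbb{Z}_{\ge 0}$-linear combinations of $b_1,\ldots,b_n$. For $S$ with minimal generators $a_1,\ldots,a_k$, an expression $S = t'S' + t''S''$ with $S' = \langle b_1,\ldots,b_r\rangle$ and $S'' = \langle c_1,\ldots,c_{k-r}\rangle$ numerical semigroups (given by minimal generators) is called a gluing if $t' \in S'' \setminus \{c_1,\ldots,c_{k-r}\}$, $t'' \in S' \setminus \{b_1,\ldots,b_r\}$, and $\gcd(t',t'') = 1$. Such an expression need not be unique; if $k = 3$ there can be up to 3 such expressions, each of the form $S = \langle a_i\rangle + t'S'$ for some $i \in \{1,2,3\}$ (expressions differing only by the order of the two summands are regarded as the same). For $x \in S$, $\mathsf Z(x) = \{z \in \mathbb{Z}_{\ge 0}^3 : x = z_1a_1 + z_2a_2 + z_3a_3\}$; $\ell_0(z) = |\{i : z_i > 0\}|$; $\mathcal L_0(x) = \{\ell_0(z) : z \in \mathsf Z(x)\} = \{d_1 < \cdots < d_r\}$; $\Delta_0(x) = \{d_i - d_{i-1} : i = 2,\ldots,r\}$; $\Delta_0(S) = \bigcup_{x \in S}\Delta_0(x)$. *)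

(* Defs.v *)
From mathcomp Require Import all_boot.
From mathcomp Require Import boolp classical_sets cardinality.

Set Implicit Arguments.
Unset Strict Implicit.
Unset Printing Implicit Defensive.

Local Open Scope classical_set_scope.
Local Open Scope nat_scope.

Definition numerical_semigroup (S : set nat) : Prop :=
  [/\ S 0, forall x y, S x -> S y -> S (x + y) & finite_set (~` S)].

Definition factorizations (a : seq nat) (x : nat) : set ((size a).-tuple nat) :=
  [set z | x = \sum_(i < size a) tnth z i * nth 0 a i].
Arguments factorizations : clear implicits.

Definition generated (a : seq nat) : set nat :=
  [set x | exists z, factorizations a x z].

(* Generating sets are listed in strictly increasing order, so that a finite
   set of generators is the same thing as a list, and its subsets are its
   subsequences. *)
Definition minimal_generators (a : seq nat) (S : set nat) : Prop :=
  [/\ sorted ltn a, generated a = S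
    & forall b, subseq b a -> generated b = S -> b = a].

Definition sumset_dil (t1 : nat) (S1 : set nat) (t2 : nat) (S2 : set nat) :
    set nat :=
  [set t1 * x + t2 * y | x in S1 & y in S2].

(* ((t', S'), (t'', S'')) stands for the expression t' S' + t'' S''. *)
Definition expression : Type := ((nat * set nat) * (nat * set nat))%type.

Definition is_gluing (S : set nat) (e : expression) : Prop :=
  let: ((t1, S1), (t2, S2)) := e in
  exists a b c : seq nat,
    [/\ [/\ minimal_generators a S, minimal_generators b S1,
            minimal_generators c S2 & size a = size b + size c],
        numerical_semigroup S1 /\ numerical_semigroup S2,
        S = sumset_dil t1 S1 t2 S2,
        (S2 `\` [set` c]) t1 /\ (S1 `\` [set` b]) t2
      & gcdn t1 t2 = 1].

Definition same_expression (e f : expression) : Prop :=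
  e = f \/ e = (f.2, f.1).

Definition at_most_one_gluing (S : set nat) : Prop :=
  forall e f, is_gluing S e -> is_gluing S f -> same_expression e f.

Definition ell0 (k : nat) (z : k.-tuple nat) : nat :=
  #|[pred i : 'I_k | 0 < tnth z i]|.

Definition lengths0 (a : seq nat) (x : nat) : set nat :=
  [set ell0 z | z in factorizations a x].

(* Differences of consecutive elements of a finite set of naturals. *)
Definition gaps (L : set nat) : set nat :=
  [set d | exists s : seq nat,
    [/\ sorted ltn s, L = [set` s]
      & exists2 i, i.+1 < size s & d = nth 0 s i.+1 - nth 0 s i]].

(* Delta_0 of the semigroup with list of minimal generators a. *)
Definition Delta0 (a : seq nat) : set nat :=
  \bigcup_(x in generated a) gaps (lengths0 a x).

(* Main.v *)
Require Import Defs.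
From mathcomp Require Import all_boot.
From mathcomp Require Import boolp classical_sets cardinality.
From mathcomp Require Import zify ring.

(** Write x, y, z for the generators in some order.

    Gluings. A gluing splits the three generators into a single one, x, and a
    pair y, z. The factor belonging to x is the semigroup of all naturals, and
    the other factor is determined: with g = gcd(y, z), the expression is
    g <y/g, z/g> + x N, and it is a gluing exactly when g x lies in <y, z>
    ([glued]). So the number of gluings up to order is the number of generators
    that are glued ([gluing_classification], [at_most_one_gluingP]).

    Gaps. A nonzero element has support sizes in {1, 2, 3}, the gap 1 is
    realized by 2 x y, and the gap 2 occurs exactly when some n is a multiple
    of a generator and has a factorization using all three generators but none
    using exactly two ([skips2], [Delta0_2]). The theorem is therefore the
    equivalence [skips2P]: such an n exists iff at most one generator is glued.

    If z is not glued, then z is not in <x/g, y/g> for g = gcd(x, y), and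
    reducing modulo y/g gives a relation s x = t y + g z with t > 0 and
    s x < lcm(x, y) ([nonglued_relation]). Adding x, the multiple (s + 1) x has
    a factorization of full support. So the least multiple n x of x with this
    property comes too early to be written with exactly x and y, since that
    would make (n - u) x, for some u > 0, a common multiple of x and y. When y
    and z are both not glued, it remains to exclude a factorization with
    exactly y and z. If x is glued, divisibility by gcd(y, z) excludes it. If
    no generator is glued, one takes the least number that is a multiple of
    some generator and has full support: comparing its two factorizations
    would give a smaller number of the same kind ([no_pos2_of_global_least]).

    If two generators are glued, then one generator, say z, divides
    gcd(z, x) gcd(z, y) ([two_glued_dvdn]). Whenever n is a multiple of x or z,
    the coefficient of y in any factorization of n is divisible by gcd(z, x),
    so that this term is a multiple of z and can be absorbed in the z term;
    this turns full support into support of size two ([absorb]). *)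

Local Open Scope classical_set_scope.
Local Open Scope nat_scope.

(** * Minimal generating sets *)

Lemma generated0 a : generated a 0.
Proof.
exists [tuple 0 | i < size a]; rewrite /factorizations /= big1 // => i _.
by rewrite tnth_mktuple.
Qed.

Lemma generatedD a x y : generated a x -> generated a y -> generated a (x + y).
Proof.
move=> [z ->] [w ->]; exists [tuple tnth z i + tnth w i | i < size a].
rewrite /factorizations /= -big_split /=; apply: eq_bigr => i _.
by rewrite tnth_mktuple mulnDl.
Qed.

Lemma generated_mem a x : x \in a -> generated a x.
Proof.
move=> xa; have ia : index x a < size a by rewrite index_mem.
exists [tuple (i == Ordinal ia) : nat | i < size a].
rewrite /factorizations /= (bigD1 (Ordinal ia)) //= big1 => [|i /negPf ni].
  by rewrite tnth_mktuple eqxx mul1n nth_index // addn0.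
by rewrite tnth_mktuple ni.
Qed.

(** An induction principle: it replaces sums over tuples of coefficients by
    closure under addition. *)
Lemma generated_min a (T : set nat) : T 0 ->
  (forall x y, T x -> T y -> T (x + y)) -> (forall x, x \in a -> T x) ->
  generated a `<=` T.
Proof.
move=> T0 TD Ta _ [z ->]; apply: big_ind => // i _.
have Ti : T (nth 0 a i) by apply: Ta; rewrite mem_nth.
by elim: (tnth z i) => [|n IH]; rewrite ?mul0n // mulSn; apply: TD.
Qed.

Lemma generatedM a n x : generated a x -> generated a (n * x).
Proof.
move=> ax; elim: n => [|n IH]; rewrite ?mul0n ?mulSn; first exact: generated0.
exact: generatedD.
Qed.

Lemma generated_sub {a b} : {subset a <= b} -> generated a `<=` generated b.
Proof.
move=> ab; apply: generated_min; first exact: generated0.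
- exact: generatedD.
- by move=> x /ab; apply: generated_mem.
Qed.

Lemma generated_cons a x n : generated (x :: a) n <->
  exists p m, generated a m /\ n = p * x + m.
Proof.
split.
  pose T := [set n | exists p m, generated a m /\ n = p * x + m].
  apply: (@generated_min _ T).
  - by exists 0, 0; split=> //; apply: generated0.
  - move=> _ _ [p [m [am ->]]] [q [l [al ->]]]; exists (p + q), (m + l); split.
      exact: generatedD.
    by rewrite mulnDl; lia.
  - move=> y; rewrite inE => /orP[/eqP->|ya].
      by exists 1, 0; split; [apply: generated0 | lia].
    by exists 0, y; split; [apply: generated_mem | lia].
move=> [p [m [am ->]]]; apply: generatedD.
  by apply/generatedM/generated_mem; rewrite mem_head.
by apply: generated_sub am => y ya; rewrite inE ya orbT.
Qed.

Lemma generated_nil n : generated [::] n -> n = 0.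
Proof. by apply: (@generated_min _ [set 0]) => // x y /= -> ->. Qed.

Lemma generated1 x n : generated [:: x] n <-> exists p, n = p * x.
Proof.
rewrite generated_cons; split=> [[p [_ [/generated_nil-> ->]]]|[p ->]].
  by exists p; rewrite addn0.
by exists p, 0; split; [exact: generated0 | rewrite addn0].
Qed.

Definition span2 (y z n : nat) : Prop := exists u v, n = u * y + v * z.

Lemma generated2 x y n : generated [:: x; y] n <-> span2 x y n.
Proof.
rewrite generated_cons; split=> [[p [_ [/generated1[q ->] ->]]]|[p [q ->]]].
  by exists p, q.
by exists p, (q * y); split=> //; apply/generated1; exists q.
Qed.

Lemma generated3 x y z n : generated [:: x; y; z] n <->
  exists p q r, n = p * x + q * y + r * z.
Proof.
rewrite generated_cons; split.
  by move=> [p [_ [/generated2[q [r ->]] ->]]]; exists p, q, r; lia.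
move=> [p [q [r ->]]]; exists p, (q * y + r * z); split; last by lia.
by apply/generated2; exists q, r.
Qed.

Definition atom (S : set nat) (x : nat) : Prop :=
  x != 0 /\ forall y z, S y -> S z -> x = y + z -> y = 0 \/ z = 0.

(** Writing the generator x as a sum, either x occurs in one of the summands,
    which leaves nothing for the other, or it is generated by the others. *)
Lemma atom_generated a x : x \in a ->
  ~ generated [seq y <- a | y != x] x -> atom (generated a) x.
Proof.
set a' := filter _ a => xa nx.
have x0 : x != 0 by apply/eqP=> x0; apply: nx; rewrite x0; exact: generated0.
split=> // y z ay az xyz.
have sub : {subset a <= x :: a'}.
  by move=> w wa; rewrite inE mem_filter wa andbT; case: eqP.
have /generated_cons[p [y' [ay' ey]]] := generated_sub sub _ ay.
have /generated_cons[q [z' [az' ez]]] := generated_sub sub _ az.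
have [pq|pq] := posnP (p + q).
  have [p0 q0] : p = 0 /\ q = 0 by lia.
  by case: nx; rewrite xyz ey ez p0 q0; apply: generatedD.
by rewrite ey ez; case: p q ey ez pq => [|p] [|q] //=; nia.
Qed.

Lemma atom_mem c x : generated c x -> atom (generated c) x -> x \in c.
Proof.
pose T n := generated c n /\ (atom (generated c) n -> n \in c).
suff sub : generated c `<=` T by move=> /sub[].
apply: generated_min.
- by split=> [|[]//]; apply: generated0.
- move=> y z [cy ay] [cz az]; split; first exact: generatedD.
  move=> at_yz; have [_ /(_ y z cy cz erefl)[e|e]] := at_yz.
    by move: at_yz az; rewrite e add0n => h; apply.
  by move: at_yz ay; rewrite e addn0 => h; apply.
- by move=> y yc; split=> // ; apply: generated_mem.
Qed.

Definition redundant_free (a : seq nat) : Prop :=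
  forall x, x \in a -> ~ generated [seq y <- a | y != x] x.

(** Each generator outside the span of the others is an atom, and atoms belong
    to every generating list; hence removing generators one at a time is enough
    to test minimality. *)
Lemma minimal_generatorsP a S : minimal_generators a S <->
  [/\ sorted ltn a, generated a = S & redundant_free a].
Proof.
split=> [] [sa ga ma]; split=> //.
  move=> x xa ax; set a' := filter _ a in ax.
  have e : a' = a.
    apply: ma; first exact: filter_subseq.
    rewrite -ga; apply/seteqP; split.
      by apply: generated_sub => y; rewrite mem_filter => /andP[].
    apply: generated_min; [exact: generated0|exact: generatedD|].
    move=> y ya; case: (eqVneq y x) => [->//|yx].
    by apply: generated_mem; rewrite mem_filter yx.
  by move: xa; rewrite -e mem_filter eqxx.
move=> b ba gb; apply: (irr_sorted_eq ltn_trans ltnn) => //.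
  exact: (subseq_sorted ltn_trans ba).
move=> x; apply/idP/idP; first exact: (mem_subseq ba).
move=> xa; have gab : generated a = generated b by rewrite ga gb.
apply: atom_mem; rewrite -gab; first exact: generated_mem.
exact: atom_generated (ma x xa).
Qed.

(** Minimal generators are atoms, so every generating list contains them. *)
Lemma minimal_generators_sub a c S : minimal_generators a S ->
  generated c = S -> {subset a <= c}.
Proof.
move=> /minimal_generatorsP[_ ga fa] gc x xa.
apply: atom_mem; rewrite gc -ga; first exact: generated_mem.
exact: atom_generated (fa x xa).
Qed.

Lemma minimal_generators_uniq a b S :
  minimal_generators a S -> minimal_generators b S -> a = b.
Proof.
move=> ma mb; apply: (irr_sorted_eq ltn_trans ltnn).
- by case: ma.
- by case: mb.
- have [_ ga _] := ma; have [_ gb _] := mb.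
  by move=> x; apply/idP/idP; apply: minimal_generators_sub; eassumption.
Qed.

Lemma cofinite_bound (S : set nat) : finite_set (~` S) ->
  exists N, forall n, N <= n -> S n.
Proof.
move=> /finite_seqP[s es]; exists (\max_(i <- s) i).+1 => n le_n.
apply: contrapT => nS; have : n \in s by have : (~` S) n by []; rewrite es.
by move=> ns; have := @leq_bigmax_seq _ s xpredT id n ns isT; lia.
Qed.

(** A cofinite set contains two consecutive numbers. *)
Lemma semigroup_coprime a d : numerical_semigroup (generated a) ->
  (forall x, x \in a -> d %| x) -> d = 1.
Proof.
move=> [_ _ /cofinite_bound[N aN]] da.
have sub : generated a `<=` [set n | d %| n].
  by apply: generated_min => //= x y; apply: dvdn_add.
apply/eqP; rewrite -dvdn1 -(@dvdn_addr N).
  exact/sub/aN/leq_addr.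
exact/sub/aN.
Qed.

(** * Factorization supports of three generators *)

Definition pos2 (y z n : nat) : Prop :=
  exists u v, [/\ 0 < u, 0 < v & n = u * y + v * z].

Definition pos3 (x y z n : nat) : Prop :=
  exists p q r, [/\ 0 < p, 0 < q, 0 < r & n = p * x + q * y + r * z].

(** The arithmetic content of having x, y, z as minimal generators of a
    numerical semigroup, in a form that does not depend on their order. *)
Definition min_triple (x y z : nat) : Prop :=
  [/\ gcdn x (gcdn y z) = 1, ~ span2 y z x, ~ span2 x z y & ~ span2 x y z].

(** The membership of x in <y/g, z/g>, with g = gcd(y, z), cleared of its
    denominators. *)
Definition glued (x y z : nat) : Prop := span2 y z (gcdn y z * x).

(** The support sizes 1 and 3 occur for n, and 2 does not. *)
Definition skips2 (x y z n : nat) : Prop :=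
  [/\ pos3 x y z n, [\/ x %| n, y %| n | z %| n]
    & [/\ ~ pos2 x y n, ~ pos2 x z n & ~ pos2 y z n]].

Lemma span2C y z n : span2 y z n -> span2 z y n.
Proof. by move=> [u [v ->]]; exists v, u; rewrite addnC. Qed.

Lemma pos2C y z n : pos2 y z n -> pos2 z y n.
Proof. by move=> [u [v [? ? ->]]]; exists v, u; split=> //; rewrite addnC. Qed.

Lemma pos3_swap x y z n : pos3 x y z n -> pos3 y x z n.
Proof. by move=> [p [q [r [? ? ? ->]]]]; exists q, p, r; split=> //; lia. Qed.

Lemma pos3_rot x y z n : pos3 x y z n -> pos3 y z x n.
Proof. by move=> [p [q [r [? ? ? ->]]]]; exists q, r, p; split=> //; lia. Qed.

Lemma min_triple_swap x y z : min_triple x y z -> min_triple y x z.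
Proof.
move=> [g nx ny nz]; split=> //; first by rewrite gcdnCA.
by move=> /span2C.
Qed.

Lemma min_triple_rot x y z : min_triple x y z -> min_triple y z x.
Proof.
move=> [g nx ny nz]; split; first by rewrite gcdnA gcdnC.
- by move=> /span2C.
- by move=> /span2C.
- by [].
Qed.

Lemma glued_sym x y z : glued x y z -> glued x z y.
Proof. by rewrite /glued gcdnC => /span2C. Qed.

Lemma skips2_swap x y z n : skips2 x y z n -> skips2 y x z n.
Proof.
move=> [f d [n1 n2 n3]]; split; first exact: pos3_swap.
  by case: d => ?; [apply: Or32|apply: Or31|apply: Or33].
by split=> // /pos2C.
Qed.

Lemma skips2_rot x y z n : skips2 x y z n -> skips2 y z x n.
Proof.
move=> [f d [n1 n2 n3]]; split; first exact: pos3_rot.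
  by case: d => ?; [apply: Or33|apply: Or31|apply: Or32].
by split=> // /pos2C.
Qed.

Lemma min_triple_gt0 {x y z} : min_triple x y z -> [/\ 0 < x, 0 < y & 0 < z].
Proof.
move=> [_ nx ny nz]; split; rewrite lt0n; apply/eqP=> e;
  [apply: nx | apply: ny | apply: nz]; by exists 0, 0.
Qed.

Lemma min_triple_coprime {x y z} : min_triple x y z -> coprime (gcdn y z) x.
Proof. by move=> [g _ _ _]; rewrite /coprime gcdnC g. Qed.

(** Divide by g and put e = x/g, d = y/g, which are coprime. Some multiple
    s e with s < d is congruent to z modulo d. It must exceed z, since
    otherwise z would lie in <e, d>; so s e = z + t d with t > 0. *)
Lemma nonglued_relation x y z : min_triple x y z -> ~ glued z x y ->
  exists s t, [/\ 0 < t, s * x = t * y + gcdn x y * z & s * x < lcmn x y].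
Proof.
move=> m ng; have [x0 y0 z0] := min_triple_gt0 m.
set g := gcdn x y; have g0 : 0 < g by rewrite gcdn_gt0 x0.
have [e ex] := dvdnP (dvdn_gcdl x y); have [d dy] := dvdnP (dvdn_gcdr x y).
rewrite -/g in ex dy.
have cop : coprime e d.
  have : g * gcdn e d = g by rewrite muln_gcdr mulnC -ex mulnC -dy.
  by rewrite /coprime => h; apply/eqP; nia.
have e0 : 0 < e by nia.
have d0 : 0 < d by nia.
(* w is the multiple s e of e below e d that is congruent to z modulo d. *)
pose w := chinese e d 0 z %% (e * d).
have [s ws] : exists s, w = s * e.
  apply/dvdnP; rewrite /dvdn modn_dvdm ?dvdn_mulr //.
  by rewrite chinese_modl // mod0n.
have wz : w = z %[mod d].
  by rewrite /w modn_dvdm ?dvdn_mull // chinese_modr.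
have wlt : w < e * d by rewrite ltn_mod muln_gt0 e0.
have sd : s < d by nia.
have lcmE : lcmn x y = d * x.
  by apply/eqP; rewrite -(eqn_pmul2r g0) muln_lcm_gcd; apply/eqP; nia.
case: (leqP w z) => wle.
  case: ng; have /dvdnP[t ht] : d %| z - w by rewrite -eqn_mod_dvd // wz.
  by exists s, t; rewrite -/g ex dy; nia.
have /dvdnP[t ht] : d %| w - z by rewrite -eqn_mod_dvd 1?ltnW // wz.
exists s, t; rewrite lcmE; split; [nia | rewrite ex dy; nia | nia].
Qed.

Lemma nonglued_pos3 x y z : min_triple x y z -> ~ glued z x y ->
  exists s, pos3 x y z (s.+1 * x) /\ s * x < lcmn x y.
Proof.
move=> m ng; have [s [t [t0 es lt_s]]] := nonglued_relation _ _ _ m ng.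
have [x0 _ _] := min_triple_gt0 m.
exists s; split=> //; exists 1, t, (gcdn x y); split=> //.
  by rewrite gcdn_gt0 x0.
by rewrite mulSn es; lia.
Qed.

(** A factorization n x = u x + v y would make (n - u) x a positive common
    multiple of x and y, while n - u is less than n, and minimality bounds n
    by the relation found for the nonglued generator z. *)
Lemma no_pos2_of_least x y z n : min_triple x y z -> ~ glued z x y ->
  (forall m, pos3 x y z (m * x) -> n <= m) -> ~ pos2 x y (n * x).
Proof.
move=> m ng least [u [v [u0 v0 e]]].
have [x0 y0 z0] := min_triple_gt0 m.
have [s [/least ns lt_s]] := nonglued_pos3 _ _ _ m ng.
have e' : (n - u) * x = v * y by nia.
have : lcmn x y <= (n - u) * x.
  rewrite dvdn_leq //; first by rewrite e' muln_gt0 v0.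
  by rewrite dvdn_lcm dvdn_mull // e' dvdn_mull.
by nia.
Qed.

Lemma skips2_of_least x y z n : min_triple x y z ->
  ~ glued y x z -> ~ glued z x y ->
  pos3 x y z (n * x) -> (forall m, pos3 x y z (m * x) -> n <= m) ->
  ~ pos2 y z (n * x) -> skips2 x y z (n * x).
Proof.
move=> m ny nz f least nyz; split=> //; first by apply: Or31; rewrite dvdn_mull.
split=> //; first exact: no_pos2_of_least m nz least.
have m' : min_triple x z y by apply/min_triple_rot/min_triple_swap.
apply: no_pos2_of_least m' ny _ => k h; apply: least.
exact/pos3_swap/pos3_rot/pos3_rot.
Qed.

(** Copies of x beyond the first can be removed from both sides. *)
Lemma least_pos3_coef1 x y z n : min_triple x y z ->
  pos3 x y z (n * x) -> (forall m, pos3 x y z (m * x) -> n <= m) ->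
  exists q r, [/\ 0 < q, 0 < r & n * x = x + q * y + r * z].
Proof.
move=> m [p [q [r [p0 q0 r0 e]]]] least; have [x0 y0 z0] := min_triple_gt0 m.
have : n <= n - p.-1.
  by apply: least; exists 1, q, r; split=> //; nia.
by move=> h; exists q, r; split=> //; nia.
Qed.

Lemma least_nat (P : nat -> Prop) n : P n ->
  exists m, P m /\ forall k, P k -> m <= k.
Proof.
move=> Pn; have ex : exists n, `[< P n >] by exists n; apply/asboolP.
exists (ex_minn ex); case: ex_minnP => m /asboolP Pm least; split=> // k Pk.
by apply: least; apply/asboolP.
Qed.

(** If n x = x + q y + r z also had a factorization by y and z alone, then
    gcd(y, z) would divide x. It would then be 1, and gluing at x would say
    that x is generated by y and z. *)
Lemma skips2_one_glued x y z : min_triple x y z ->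
  glued x y z -> ~ glued y x z -> ~ glued z x y -> exists n, skips2 x y z n.
Proof.
move=> m gx ny nz.
have [n0 [fn0 _]] := nonglued_pos3 _ _ _ m nz.
have [n [fn least]] := least_nat (fun n => pos3 x y z (n * x)) n0.+1 fn0.
exists (n * x); apply: skips2_of_least => //.
have [q [r [q0 r0 e]]] := least_pos3_coef1 _ _ _ _ m fn least.
move=> [u [v [u0 v0 e']]].
have gdx : gcdn y z %| x.
  have h : gcdn y z %| x + (q * y + r * z).
    by rewrite addnA -e e' dvdn_add // dvdn_mull // ?dvdn_gcdl ?dvdn_gcdr.
  rewrite -(dvdn_addl x (n := q * y + r * z)) //.
  by rewrite dvdn_add // dvdn_mull // ?dvdn_gcdl ?dvdn_gcdr.
have g1 : gcdn y z = 1.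
  by move: (min_triple_coprime m); rewrite /coprime (gcdn_idPl gdx) => /eqP.
by case: m => _ nx _ _; apply: nx; move: gx; rewrite /glued g1 mul1n.
Qed.

(** Compare n x = x + q y + r z with n x = u y + v z. As x is not generated by
    y and z, exactly one coefficient grows, say that of y. Cancelling gives
    x + (r - v) z = (u - q) y, and adding y to both sides gives a multiple of y
    with full support which is smaller than n x. *)
Lemma no_pos2_of_global_least x y z n : min_triple x y z ->
  pos3 x y z (n * x) ->
  (forall m, pos3 x y z m -> [\/ x %| m, y %| m | z %| m] -> n * x <= m) ->
  ~ pos2 y z (n * x).
Proof.
move=> m f least [u [v [u0 v0 e]]]; have [x0 y0 z0] := min_triple_gt0 m.
have [q [r [q0 r0 e']]] :
    exists q r, [/\ 0 < q, 0 < r & n * x = x + q * y + r * z].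
  apply: least_pos3_coef1 => // k fk; rewrite -(leq_pmul2r x0).
  by apply: least => //; apply: Or31; rewrite dvdn_mull.
have nx : ~ span2 y z x by case: m.
case: (leqP q u) => qu; case: (leqP r v) => rv.
- by apply: nx; exists (u - q), (v - r); nia.
- have : n * x <= x + y + (r - v) * z.
    apply: least; first by exists 1, 1, (r - v); split=> //; lia.
    by apply: Or32; apply/dvdnP; exists (u - q).+1; nia.
  by nia.
- have : n * x <= x + (q - u) * y + z.
    apply: least; first by exists 1, (q - u), 1; split=> //; lia.
    by apply: Or33; apply/dvdnP; exists (v - r).+1; nia.
  by nia.
- by nia.
Qed.

Lemma skips2_of_global_least x y z n : min_triple x y z ->
  ~ glued y x z -> ~ glued z x y -> pos3 x y z n -> x %| n ->
  (forall m, pos3 x y z m -> [\/ x %| m, y %| m | z %| m] -> n <= m) ->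
  skips2 x y z n.
Proof.
move=> m ny nz f /dvdnP[k ek] least; rewrite ek in f least *.
have [x0 _ _] := min_triple_gt0 m.
apply: skips2_of_least => //; last exact: no_pos2_of_global_least.
move=> l fl; rewrite -(leq_pmul2r x0); apply: least => //.
by apply: Or31; rewrite dvdn_mull.
Qed.

Lemma skips2_none_glued x y z : min_triple x y z ->
  ~ glued x y z -> ~ glued y x z -> ~ glued z x y -> exists n, skips2 x y z n.
Proof.
move=> m nx ny nz.
have [n0 [fn0 _]] := nonglued_pos3 _ _ _ m nz.
have [n [[fn dn] least]] := least_nat
  (fun n => pos3 x y z n /\ [\/ x %| n, y %| n | z %| n]) (n0.+1 * x)
  (conj fn0 (Or31 _ _ (dvdn_mull _ (dvdnn x)))).
exists n; case: dn => dn.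
- by apply: skips2_of_global_least => // k fk dk; apply: least.
- apply/skips2_swap; apply: skips2_of_global_least => //.
  + exact: min_triple_swap.
  + by move=> /glued_sym.
  + exact: pos3_swap.
  + move=> k fk dk; apply: least; split; first exact: pos3_swap.
    by case: dk => ?; [apply: Or32|apply: Or31|apply: Or33].
- apply/skips2_rot; apply: skips2_of_global_least => //.
  + exact/min_triple_rot/min_triple_rot.
  + by move=> /glued_sym.
  + by move=> /glued_sym.
  + exact/pos3_rot/pos3_rot.
  + move=> k fk dk; apply: least; split; first exact: pos3_rot.
    by case: dk => ?; [apply: Or33|apply: Or31|apply: Or32].
Qed.

(** With g = gcd(x, y), the number x divides g z and g x, hence also their gcd,
    which is g gcd(x, z). *)
Lemma dvdn_mul_gcdr x y z : x %| gcdn x y * z -> x %| gcdn x y * gcdn x z.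
Proof. by move=> h; rewrite muln_gcdr dvdn_gcd h dvdn_mull. Qed.

(** Write g x = al y + be z and h y = ga x + de z for the two gluings, with
    g = gcd(y, z) and h = gcd(x, z). If a coefficient vanishes, then a generator
    divides a gcd times another generator. If none does, h divides al by
    coprimality, so that g x > h y, and symmetrically h y > g x. *)
Lemma two_glued_dvdn x y z : min_triple x y z -> glued x y z -> glued y x z ->
  [\/ x %| gcdn x y * gcdn x z, y %| gcdn y x * gcdn y z
    | z %| gcdn z x * gcdn z y].
Proof.
move=> m [al [be ex]] [ga [de ey]]; have [x0 y0 z0] := min_triple_gt0 m.
have [al0|al0] := posnP al.
  apply: Or33; rewrite mulnC; apply: dvdn_mul_gcdr.
  by rewrite gcdnC ex al0 mul0n dvdn_mull.
have [be0|be0] := posnP be.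
  apply: Or32; rewrite mulnC; apply: dvdn_mul_gcdr.
  by rewrite ex be0 mul0n addn0 dvdn_mull.
have [ga0|ga0] := posnP ga.
  apply: Or33; apply: dvdn_mul_gcdr.
  by rewrite gcdnC ey ga0 mul0n dvdn_mull.
have [de0|de0] := posnP de.
  apply: Or31; rewrite mulnC; apply: dvdn_mul_gcdr.
  by rewrite ey de0 mul0n addn0 dvdn_mull.
have dal : gcdn x z <= al.
  apply: dvdn_leq => //.
  rewrite -(Gauss_dvdl al (min_triple_coprime (min_triple_swap _ _ _ m))).
  rewrite -(@dvdn_addl (be * z)) ?dvdn_mull ?dvdn_gcdr //.
  by rewrite -ex dvdn_mull // dvdn_gcdl.
have dga : gcdn y z <= ga.
  apply: dvdn_leq => //.
  rewrite -(Gauss_dvdl ga (min_triple_coprime m)).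
  rewrite -(@dvdn_addl (de * z)) ?dvdn_mull ?dvdn_gcdr //.
  by rewrite -ey dvdn_mull // dvdn_gcdl.
have h1 : gcdn x z * y <= al * y by rewrite leq_mul2r dal orbT.
have h2 : gcdn y z * x <= ga * x by rewrite leq_mul2r dga orbT.
by nia.
Qed.

(** The number gcd(z, x) divides n, x and z and is coprime to y, so it divides
    the coefficient q of y. Then z divides q y, and this term becomes a
    multiple of z. *)
Lemma absorb x y z n : min_triple x y z -> z %| gcdn z x * gcdn z y ->
  pos3 x y z n -> gcdn z x %| n -> pos2 x z n.
Proof.
move=> m dz [p [q [r [p0 q0 r0 e]]]] dn; have [x0 y0 z0] := min_triple_gt0 m.
have dq : gcdn z x %| q.
  have cop : coprime (gcdn z x) y.
    exact/min_triple_coprime/min_triple_rot.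
  rewrite -(Gauss_dvdl q cop) -(@dvdn_addl (p * x + r * z)).
    by have -> : q * y + (p * x + r * z) = n by lia.
  by rewrite dvdn_add // dvdn_mull // ?dvdn_gcdl ?dvdn_gcdr.
have /dvdnP[w ew] : z %| q * y.
  by apply: dvdn_trans dz _; rewrite dvdn_mul // dvdn_gcdr.
by exists p, (r + w); split=> //; nia.
Qed.

Lemma dvdn_no_skips2 x y z n : min_triple x y z -> z %| gcdn z x * gcdn z y ->
  ~ skips2 x y z n.
Proof.
move=> m dz [f d [nxy nxz nyz]].
case: d => d.
- by apply: nxz; apply: absorb f _ => //; apply: dvdn_trans (dvdn_gcdr _ _) d.
- apply: nyz; apply: (absorb y x); rewrite 1?mulnC //.
  + exact: min_triple_swap.
  + exact: pos3_swap.
  + exact: dvdn_trans (dvdn_gcdr _ _) d.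
- by apply: nxz; apply: absorb f _ => //; apply: dvdn_trans (dvdn_gcdl _ _) d.
Qed.

Lemma two_glued_no_skips2 x y z n : min_triple x y z ->
  glued x y z -> glued y x z -> ~ skips2 x y z n.
Proof.
move=> m gx gy sk; case: (two_glued_dvdn _ _ _ m gx gy) => d.
- by apply: (dvdn_no_skips2 y z x n) => //;
    [exact: min_triple_rot | exact: skips2_rot].
- apply: (dvdn_no_skips2 z x y n); rewrite 1?mulnC //;
    [exact/min_triple_rot/min_triple_rot | exact/skips2_rot/skips2_rot].
- exact: dvdn_no_skips2 m d sk.
Qed.

Lemma skips2P x y z : min_triple x y z ->
  (exists n, skips2 x y z n) <-> [/\ ~ (glued x y z /\ glued y x z),
    ~ (glued x y z /\ glued z x y) & ~ (glued y x z /\ glued z x y)].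
Proof.
move=> m; have my := min_triple_swap _ _ _ m.
have myz := min_triple_rot _ _ _ m.
have mz := min_triple_rot _ _ _ myz.
split.
  move=> [n sk]; split=> -[g1 g2].
  - exact: (two_glued_no_skips2 _ _ _ n m g1 g2).
  - apply: (two_glued_no_skips2 z x y n mz g2); first exact: glued_sym.
    exact/skips2_rot/skips2_rot.
  - apply: (two_glued_no_skips2 y z x n myz); try exact: glued_sym.
    exact: skips2_rot.
move=> [nxy nxz nyz].
have [gx|ngx] := pselect (glued x y z).
  by apply: skips2_one_glued => //; tauto.
have [gy|ngy] := pselect (glued y x z).
  have [|n sk] := skips2_one_glued y x z my gy ngx.
    by move/glued_sym; tauto.
  by exists n; apply: skips2_swap.
have [gz|ngz] := pselect (glued z x y); last exact: skips2_none_glued.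
have [||n sk] := skips2_one_glued z x y mz gz.
- by move/glued_sym.
- by move/glued_sym.
- by exists n; apply: skips2_rot.
Qed.

(** * Gaps between support sizes *)

(** Boundedness matters: an unbounded set is not the set of entries of any
    list, so it has no gaps at all. *)
Lemma gapsP (L : set nat) N d : (forall n, L n -> n < N) ->
  gaps L d <-> exists l, [/\ L l, L (l + d), 0 < d
                           & forall m, l < m < l + d -> ~ L m].
Proof.
move=> LN; split.
  move=> [s [ss Ls [i lt_i ->]]]; exists (nth 0 s i).
  have lt_nth j k : j < k < size s -> nth 0 s j < nth 0 s k.
    move=> /andP[jk ks]; rewrite (sorted_ltn_nth ltn_trans) // inE //.
    exact: ltn_trans jk ks.
  have step := lt_nth i i.+1.
  rewrite leqnn lt_i in step; have {}step := step isT.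
  have {}Ls k : L k <-> k \in s by rewrite Ls.
  rewrite (subnKC (ltnW step)); split.
  - by apply/Ls; rewrite mem_nth // ltnW.
  - by apply/Ls; rewrite mem_nth.
  - by rewrite subn_gt0.
  - move=> m + /Ls/(nthP 0)[j lt_j ej]; rewrite -ej => /andP[l1 l2].
    case: (ltngtP j i) => [ji|ij|ji].
    + have := lt_nth j i; rewrite ji (ltnW lt_i) => /(_ isT).
      by move=> /(ltn_trans l1); rewrite ltnn.
    + case: (ltngtP j i.+1) => [|ij'|ij']; first by lia.
        have := lt_nth i.+1 j; rewrite ij' lt_j => /(_ isT).
        by move=> /(ltn_trans l2); rewrite ltnn.
      by move: l2; rewrite ij' ltnn.
    + by move: l1; rewrite ji ltnn.
move=> [l [Ll Lld d0 between]].
pose lo := [seq m <- iota 0 l | `[< L m >]].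
pose hi := [seq m <- iota (l + d).+1 (N - (l + d).+1) | `[< L m >]].
have mem_lo m : m \in lo = `[< L m >] && (m < l).
  by rewrite mem_filter mem_iota add0n.
have mem_hi m : m \in hi = `[< L m >] && (l + d < m).
  rewrite mem_filter mem_iota; case: asboolP => //= /LN mN; lia.
have ltntr := ltn_trans.
exists (lo ++ [:: l, l + d & hi]); split.
- rewrite sorted_pairwise // pairwise_cat.
  rewrite -!sorted_pairwise // /= path_sortedE //.
  rewrite !sorted_filter ?iota_ltn_sorted //.
  rewrite !andbT; apply/and4P; split=> //.
  + apply/allrelP => m n; rewrite mem_lo !inE mem_hi => /andP[_ ml].
    by move=> /or3P[/eqP->|/eqP->|/andP[_ ?]]; lia.
  + lia.
  + by apply/allP => m; rewrite mem_hi => /andP[].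
- apply/seteqP; split=> m /=; rewrite mem_cat !inE mem_lo mem_hi.
    move=> Lm; have -> : `[< L m >] by apply/asboolP.
    have := between m.
    case: (ltnP l m) => //= ?; case: (ltnP m (l + d)) => //= ?.
    + by move=> /(_ isT).
    + by move=> _; lia.
    + by move=> _; lia.
    + by move=> _; lia.
  by case/or4P=> [/andP[/asboolP]|/eqP->|/eqP->|/andP[/asboolP]].
(* The list is split so that l is the entry with index size lo. *)
- exists (size lo); first by rewrite size_cat /=; lia.
  by rewrite !nth_cat ltnn subnn ltnNge leqnSn subSnn /= addKn.
Qed.

Lemma lengths0_3 x y z n l : lengths0 [:: x; y; z] n l <->
  exists p q r, n = p * x + q * y + r * z /\ l = (0 < p) + (0 < q) + (0 < r).
Proof.
have sum3 (F : 'I_3 -> nat) :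
    \sum_(i < 3) F i =
    F ord0 + F (lift ord0 ord0) + F (lift ord0 (lift ord0 ord0)).
  by rewrite !big_ord_recl big_ord0 addn0 addnA.
have ellE (t : 3.-tuple nat) : ell0 t =
    (0 < tnth t ord0) + (0 < tnth t (lift ord0 ord0))
    + (0 < tnth t (lift ord0 (lift ord0 ord0))).
  by rewrite /ell0 -sum1_card big_mkcond sum3 /= !inE; do 3!case: ifP.
split.
  move=> [t /= ft <-]; rewrite ellE.
  by do 3!eexists; split; last reflexivity; rewrite [n]ft sum3.
move=> [p [q [r [-> ->]]]]; exists [tuple p; q; r]; last by rewrite ellE.
by rewrite /factorizations /= sum3.
Qed.

Lemma lengths0_0 x y z n : lengths0 [:: x; y; z] n 0 -> n = 0.
Proof. by move=> /lengths0_3[[|p] [[|q] [[|r] [-> //]]]]. Qed.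

Lemma lengths0_le3 x y z n l : lengths0 [:: x; y; z] n l -> l < 4.
Proof. by move=> /lengths0_3[[|p] [[|q] [[|r] [_ ->]]]]. Qed.

Lemma lengths0_1 x y z n : 0 < n ->
  lengths0 [:: x; y; z] n 1 <-> [\/ x %| n, y %| n | z %| n].
Proof.
move=> n0; rewrite lengths0_3; split.
  move=> [p [q [r [-> e]]]].
  have : [\/ q = 0 /\ r = 0, p = 0 /\ r = 0 | p = 0 /\ q = 0].
    case: p q r e => [|p] [|q] [|r] //= _;
    by [apply: Or31|apply: Or32|apply: Or33].
  case=> -[-> ->]; rewrite !mul0n ?addn0 ?add0n.
  - by apply: Or31; rewrite dvdn_mull.
  - by apply: Or32; rewrite dvdn_mull.
  - by apply: Or33; rewrite dvdn_mull.
case=> /dvdnP[[|k] e]; rewrite ?e // in n0 *.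
- by exists k.+1, 0, 0; split=> //; lia.
- by exists 0, k.+1, 0; split=> //; lia.
- by exists 0, 0, k.+1; split=> //; lia.
Qed.

Lemma lengths0_2 x y z n : lengths0 [:: x; y; z] n 2 <->
  [\/ pos2 x y n, pos2 x z n | pos2 y z n].
Proof.
rewrite lengths0_3; split.
  move=> [[|p] [[|q] [[|r] [e //= _]]]].
  - by apply: Or33; exists q.+1, r.+1; split=> //; lia.
  - by apply: Or32; exists p.+1, r.+1; split=> //; lia.
  - by apply: Or31; exists p.+1, q.+1; split=> //; lia.
case=> -[u [v [u0 v0 ->]]].
- by exists u, v, 0; rewrite u0 v0; split=> //; lia.
- by exists u, 0, v; rewrite u0 v0; split=> //; lia.
- by exists 0, u, v; rewrite u0 v0; split=> //; lia.
Qed.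

Lemma lengths0_full x y z n : lengths0 [:: x; y; z] n 3 <-> pos3 x y z n.
Proof.
rewrite lengths0_3; split.
  move=> [[|p] [[|q] [[|r] [-> //= _]]]].
  by exists p.+1, q.+1, r.+1.
by move=> [p [q [r [p0 q0 r0 ->]]]]; exists p, q, r; rewrite p0 q0 r0.
Qed.

Lemma Delta0P x y z d : Delta0 [:: x; y; z] d <->
  exists n l, [/\ lengths0 [:: x; y; z] n l,
    lengths0 [:: x; y; z] n (l + d), 0 < d
    & forall k, l < k < l + d -> ~ lengths0 [:: x; y; z] n k].
Proof.
split.
  by move=> [n _ /(gapsP _ 4)[|l ?]]; [exact: lengths0_le3|exists n, l].
move=> [n [l [nl nld d0 nk]]]; exists n.
  apply/generated3; move: nl => /lengths0_3[p [q [r [-> _]]]].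
  by exists p, q, r.
by apply/(gapsP _ 4); [exact: lengths0_le3|exists l].
Qed.

(** The element 2 x y has the factorizations (2 y) x and y x + x y. *)
Lemma Delta0_1 x y z : min_triple x y z -> Delta0 [:: x; y; z] 1.
Proof.
move=> m; have [x0 y0 _] := min_triple_gt0 m.
apply/Delta0P; exists (2 * (x * y)), 1; split=> //.
- by apply/lengths0_1; [lia | apply: Or31; rewrite dvdn_mull // dvdn_mulr].
- by apply/lengths0_2; apply: Or31; exists y, x; split=> //; lia.
- by move=> k; lia.
Qed.

(** A gap of 2 can only jump from 1 to 3: support size 0 forces the element to
    be 0, which has no other support size. *)
Lemma Delta0_2 x y z : min_triple x y z ->
  Delta0 [:: x; y; z] 2 <-> exists n, skips2 x y z n.
Proof.
move=> m; have [x0 y0 z0] := min_triple_gt0 m.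
have pos3_gt0 n : pos3 x y z n -> 0 < n by move=> [p [q [r [? ? ? ->]]]]; nia.
rewrite Delta0P; split.
  move=> [n [l [nl nl2 _ nl1]]]; exists n.
  have l4 := lengths0_le3 _ _ _ _ _ nl2.
  have [l0|l0] := posnP l.
    have n0 : n = 0 by apply: (lengths0_0 x y z); rewrite -l0.
    move: nl2; rewrite l0 n0 => /lengths0_2.
    by case=> -[u [v [? ? ?]]]; nia.
  have l1 : l = 1 by lia.
  rewrite l1 in nl nl2 nl1; have f := nl2; move/lengths0_full in f.
  split=> //; first by apply/lengths0_1 => //; exact: pos3_gt0.
  have := nl1 2 isT; rewrite lengths0_2 => nor.
  by split=> h; apply: nor; [apply: Or31|apply: Or32|apply: Or33].
move=> [n [f d [n1 n2 n3]]]; exists n, 1; split=> //.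
- by apply/lengths0_1 => //; exact: pos3_gt0.
- exact/lengths0_full.
- move=> k kk; have -> : k = 2 by lia.
  by move=> /lengths0_2[].
Qed.

Lemma Delta0_sub x y z d : min_triple x y z ->
  Delta0 [:: x; y; z] d -> d = 1 \/ d = 2.
Proof.
move=> m; have [x0 y0 z0] := min_triple_gt0 m.
move=> /Delta0P[n [l [nl nld d0 _]]]; have l4 := lengths0_le3 _ _ _ _ _ nld.
have [l0|] := posnP l; last by lia.
case: (eqVneq d 3) => [d3|]; last by lia.
have n0 : n = 0 by apply: (lengths0_0 x y z); rewrite -l0.
move: nld; rewrite l0 d3 n0 => /lengths0_full[p [q [r [? ? ? ?]]]]; nia.
Qed.

(** * Gluings of three-generated semigroups *)

(** The only possible gluing in which x is the generator standing alone. *)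
Definition gluing_at (x y z : nat) : expression :=
  ((gcdn y z, generated [:: y %/ gcdn y z; z %/ gcdn y z]), (x, [set: nat])).

Lemma min_triple_of_generators x y z S : x < y < z -> numerical_semigroup S ->
  minimal_generators [:: x; y; z] S -> min_triple x y z.
Proof.
move=> /andP[xy yz] nS /minimal_generatorsP[_ gS free].
have [nxy nxz nyz] : [/\ x != y, x != z & y != z] by split; lia.
split.
- rewrite -gS in nS; apply: (semigroup_coprime _ _ nS) => w.
  have dg : gcdn x (gcdn y z) %| gcdn y z := dvdn_gcdr _ _.
  rewrite !inE => /or3P[] /eqP->; first exact: dvdn_gcdl.
    exact: dvdn_trans dg (dvdn_gcdl _ _).
  exact: dvdn_trans dg (dvdn_gcdr _ _).
- move=> /generated2 h; apply: (free x); first by rewrite mem_head.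
  by rewrite /= eqxx /= eq_sym nxy /= eq_sym nxz.
- move=> /generated2 h; apply: (free y); first by rewrite !inE eqxx orbT.
  by rewrite /= nxy eqxx /= eq_sym nyz.
- move=> /generated2 h; apply: (free z); first by rewrite !inE eqxx !orbT.
  by rewrite /= nxz nyz eqxx.
Qed.

Lemma minimal_generators_setT : minimal_generators [:: 1] [set: nat].
Proof.
apply/minimal_generatorsP; split=> //.
  by apply/seteqP; split=> // n _; apply/generated1; exists n; rewrite muln1.
by move=> x; rewrite inE => /eqP-> /= /generated_nil.
Qed.

(** The point is that the factor <y/g, z/g> is cofinite. Being glued at x makes
    it the set of all n with g n in S, so its complement embeds in that of S. *)
Lemma gluing_at_is_gluing x y z a S : min_triple x y z -> y < z ->
  a =i [:: x; y; z] -> size a = 3 ->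
  numerical_semigroup S -> minimal_generators a S -> glued x y z ->
  is_gluing S (gluing_at x y z).
Proof.
move=> m yz ea sa nS mS gl; have [x0 y0 z0] := min_triple_gt0 m.
have [_ nx ny nz] := m; rewrite /gluing_at.
move: (min_triple_coprime m) gl (dvdn_gcdl y z) (dvdn_gcdr y z).
rewrite /glued; set g := gcdn y z.
have g0 : 0 < g by rewrite gcdn_gt0 y0.
move=> cop gl /dvdnP[b1 eb1] /dvdnP[b2 eb2].
have -> : y %/ g = b1 by rewrite eb1 mulnK.
have -> : z %/ g = b2 by rewrite eb2 mulnK.
have SE n : S n <-> exists p q r, n = p * x + q * y + r * z.
  have [_ <- _] := mS; rewrite -generated3.
  by split; apply: generated_sub => w; rewrite ea.
have xb : span2 b1 b2 x.
  have [u [v e]] := gl; exists u, v; apply/eqP.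
  by rewrite -(eqn_pmul2l g0) e eb1 eb2; apply/eqP; lia.
have b12 : b1 < b2 by nia.
have S1E n : span2 b1 b2 n <-> S (g * n).
  split.
    by move=> [u [v ->]]; apply/SE; exists 0, u, v; rewrite eb1 eb2; lia.
  (* As g is coprime to x, it divides the coefficient p of x, and x itself is
     a combination of b1 and b2. *)
  move=> /SE[p [q [r e]]].
  have /dvdnP[p' ep] : g %| p.
    rewrite -(Gauss_dvdl p cop) -(@dvdn_addl (q * y + r * z)).
      by rewrite addnA -e dvdn_mulr.
    by rewrite dvdn_add // dvdn_mull // ?dvdn_gcdl ?dvdn_gcdr.
  have [s [t es]] := xb; exists (p' * s + q), (p' * t + r).
  apply/eqP; rewrite -(eqn_pmul2l g0) e ep eb1 eb2 es; apply/eqP.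
  ring.
have g1 : g != 1.
  by apply/eqP => g1; apply: nx; move: gl; rewrite g1 mul1n.
exists a, [:: b1; b2], [:: 1]; split.
- split=> //; last exact: minimal_generators_setT.
  apply/minimal_generatorsP; split=> //; first by rewrite /= b12.
  move=> b; rewrite !inE => /orP[] /eqP-> /=.
    rewrite eqxx /= gtn_eqF // => /generated1[p e]; apply: ny.
    by exists 0, p; rewrite eb1 eb2 e; lia.
  rewrite eqxx /= ltn_eqF // => /generated1[p e]; apply: nz.
  by exists 0, p; rewrite eb1 eb2 e; lia.
- split; split.
  + exact: generated0.
  + exact: generatedD.
  + have [_ _ /finite_seqP[s es]] := nS.
    apply: (@sub_finite_set _ _ [set` [seq n %/ g | n <- s]]);
      last exact: finite_seq.
    move=> n nn /=; apply/mapP; exists (g * n); last by rewrite mulKn.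
    have : (~` S) (g * n) by move=> /S1E/generated2.
    by rewrite es.
  + by [].
  + by [].
  + by rewrite setCT.
- apply/seteqP; split=> n.
    move=> /SE[p [q [r ->]]]; exists (q * b1 + r * b2).
      by apply/generated2; exists q, r.
    by exists p => //; rewrite eb1 eb2; lia.
  move=> [k /generated2/S1E/SE[p [q [r e]]] [t _ <-]].
  by apply/SE; exists (p + t), q, r; rewrite e; lia.
- split; first by split=> //=; rewrite inE; apply/negP.
  split; first exact/generated2.
  rewrite /= !inE => /orP[] /eqP e.
    by apply: ny; exists g, 0; rewrite eb1 e; lia.
  by apply: nz; exists g, 0; rewrite eb2 e; lia.
- exact/eqP.
Qed.

Lemma cofinite_not_nil S : numerical_semigroup S -> ~ minimal_generators [::] S.
Proof.
move=> [_ _ /cofinite_bound[N SN]] [_ gS _].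
have : S N.+1 by apply: SN.
by rewrite -gS => /generated_nil.
Qed.

Lemma semigroup1 S c : numerical_semigroup S -> minimal_generators [:: c] S ->
  c = 1 /\ S = [set: nat].
Proof.
move=> nS mS; have [_ gS _] := mS; have c1 : c = 1.
  apply: (semigroup_coprime [:: c]); rewrite ?gS // => w.
  by rewrite inE => /eqP->.
split=> //; have [_ <- _] := minimal_generators_setT.
by rewrite -gS c1.
Qed.

(** The three products t2, t1 b1, t1 b2 generate S, so they contain the three
    minimal generators and are the same three numbers. *)
Lemma gluing_generators S a t1 S1 t2 S2 b c :
  minimal_generators a S -> size a = 3 ->
  numerical_semigroup S1 -> numerical_semigroup S2 ->
  minimal_generators b S1 -> minimal_generators c S2 ->
  size c = 1 -> size b = 2 -> S = sumset_dil t1 S1 t2 S2 ->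
  exists b1 b2, [/\ S2 = [set: nat], b1 < b2, coprime b1 b2,
    S1 = generated [:: b1; b2] & a =i [:: t2; t1 * b1; t1 * b2]].
Proof.
move=> mS sa n1 n2 mb mc.
case: c mc => [//|c [|//]] mc _.
case: b mb => [//|b1 [//|b2 [|//]]] mb _ eS.
have [c1 S2T] := semigroup1 _ _ n2 mc.
have [sb gb _] := mb; exists b1, b2; split=> //.
- by move: sb; rewrite /= andbT.
- apply/eqP; apply: (semigroup_coprime [:: b1; b2]); rewrite ?gb // => w.
  by rewrite !inE => /orP[] /eqP->; [exact: dvdn_gcdl|exact: dvdn_gcdr].
- have gS : generated [:: t2; t1 * b1; t1 * b2] = S.
    rewrite eS S2T -gb; apply/seteqP; split=> n.
      move=> /generated3[p [q [r ->]]]; exists (q * b1 + r * b2).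
        by apply/generated2; exists q, r.
      by exists p => //; lia.
    move=> [_ /generated2[q [r ->]] [p _ <-]].
    by apply/generated3; exists p, q, r; lia.
  have sub := minimal_generators_sub _ _ _ mS gS.
  have ua : uniq a.
    have [+ _ _] := mS; exact: (sorted_uniq ltn_trans ltnn).
  have := uniq_min_size ua sub; rewrite sa => /(_ isT)[_ ?]; done.
Qed.

(** Both factors are cofinite, so neither list of generators is empty, and the
    three generators split as two and one in one of the two orders. *)
Lemma gluing_classification x y z S e : x < y < z ->
  minimal_generators [:: x; y; z] S -> is_gluing S e ->
  exists f, (e = f \/ e = (f.2, f.1)) /\
   [\/ f = gluing_at x y z /\ glued x y z, f = gluing_at y x z /\ glued y x z
     | f = gluing_at z x y /\ glued z x y].
Proof.
move=> xyz mS.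
have main t1 S1 t2 S2 b c :
  minimal_generators b S1 -> minimal_generators c S2 ->
  numerical_semigroup S1 -> numerical_semigroup S2 ->
  size c = 1 -> size b = 2 -> S = sumset_dil t1 S1 t2 S2 -> S1 t2 ->
  let f := ((t1, S1), (t2, S2)) in
  [\/ f = gluing_at x y z /\ glued x y z, f = gluing_at y x z /\ glued y x z
     | f = gluing_at z x y /\ glued z x y].
  move=> mb mc n1 n2 sc sb eS St2.
  have [b1 [b2 [-> b12 cop eS1 ea]]] :=
    gluing_generators _ _ _ _ _ _ _ _ mS erefl n1 n2 mb mc sc sb eS.
  have t10 : 0 < t1.
    move: (ea x) (ea y) (ea z); rewrite !inE !eqxx !orbT; case: posnP => // ->.
    by rewrite !mul0n; lia.
  have u12 : t1 * b1 < t1 * b2 by rewrite ltn_pmul2l.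
  have gE : gcdn (t1 * b1) (t1 * b2) = t1 by rewrite -muln_gcdr (eqP cop) muln1.
  have glE : glued t2 (t1 * b1) (t1 * b2).
    move: St2; rewrite eS1 /glued gE => /generated2[p [q ->]]; exists p, q; lia.
  have fE : gluing_at t2 (t1 * b1) (t1 * b2) =
      ((t1, generated [:: b1; b2]), (t2, [set: nat])).
    by rewrite /gluing_at gE !mulKn.
  rewrite /= eS1 -fE.
  have : [\/ [/\ x = t2, y = t1 * b1 & z = t1 * b2],
             [/\ y = t2, x = t1 * b1 & z = t1 * b2]
           | [/\ z = t2, x = t1 * b1 & y = t1 * b2]].
    move: (ea x) (ea y) (ea z) u12; rewrite !inE !eqxx !orbT.
    move: (t1 * b1) (t1 * b2) => u v.
    move=> /esym/or3P ex /esym/or3P ey /esym/or3P ez uv.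
    case: ex => /eqP ex; case: ey => /eqP ey; case: ez => /eqP ez; try lia;
    by [apply: Or31|apply: Or32|apply: Or33].
  by case=> -[-> -> ->]; [apply: Or31|apply: Or32|apply: Or33].
case: e => [[t1 S1] [t2 S2]] [a [b [c [[ma mb mc sz] [n1 n2] eS [h1 h2] _]]]].
have ea := minimal_generators_uniq _ _ _ ma mS; rewrite ea /= in sz.
have b0 : size b != 0.
  by apply/eqP => /size0nil e; move: mb; rewrite e; exact: cofinite_not_nil.
have c0 : size c != 0.
  by apply/eqP => /size0nil e; move: mc; rewrite e; exact: cofinite_not_nil.
have [sb|sb] : size b = 2 \/ size b = 1 by lia.
- exists ((t1, S1), (t2, S2)); split; first by left.
  by apply: (main _ _ _ _ b c) => //; [lia | case: h2].
- exists ((t2, S2), (t1, S1)); split; first by right.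
  apply: (main _ _ _ _ c b) => //; [lia | | by case: h1].
  rewrite eS; apply/seteqP; split=> _ [u Su [v Sv <-]];
  by exists v => //; exists u => //; rewrite addnC.
Qed.

Lemma gluing_atC x y z : gluing_at x y z = gluing_at x z y.
Proof.
rewrite /gluing_at (gcdnC z y); congr (_, _, _).
by apply/seteqP; split; apply: generated_sub => w; rewrite !inE orbC.
Qed.

(** If the two expressions agreed after exchanging summands, x would equal
    gcd(x, z) and divide z. *)
Lemma gluing_at_neq x y z : min_triple x y z ->
  ~ same_expression (gluing_at x y z) (gluing_at y x z).
Proof.
move=> [_ nx ny nz] [[_ _ e]|[_ _ e _]].
  by apply: nx; exists 1, 0; rewrite e; lia.
have /dvdnP[k ek] : x %| z by rewrite {1}e dvdn_gcdr.
by apply: nz; exists k, 0; rewrite ek addn0.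
Qed.

Lemma same_expression_swap e f g : e = g \/ e = (g.2, g.1) ->
  f = g \/ f = (g.2, g.1) -> same_expression e f.
Proof.
move=> [->|->] [->|->]; rewrite /same_expression /=; first by left.
- by right; case: g => [[]].
- by right.
- by left.
Qed.

Lemma at_most_one_gluingP x y z S : x < y < z -> numerical_semigroup S ->
  minimal_generators [:: x; y; z] S ->
  at_most_one_gluing S <-> [/\ ~ (glued x y z /\ glued y x z),
    ~ (glued x y z /\ glued z x y) & ~ (glued y x z /\ glued z x y)].
Proof.
move=> xyz nS mS; have m := min_triple_of_generators _ _ _ _ xyz nS mS.
have my := min_triple_swap _ _ _ m.
have myz := min_triple_rot _ _ _ m.
have mz := min_triple_rot _ _ _ myz.
have [xy yz] := andP xyz.
have gx : glued x y z -> is_gluing S (gluing_at x y z).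
  by move=> gl; apply: (gluing_at_is_gluing x y z [:: x; y; z]).
have gy : glued y x z -> is_gluing S (gluing_at y x z).
  move=> gl; apply: (gluing_at_is_gluing y x z [:: x; y; z]) => //.
    exact: ltn_trans xy yz.
  by move=> w; rewrite !inE orbCA.
have gz : glued z x y -> is_gluing S (gluing_at z x y).
  move=> gl; apply: (gluing_at_is_gluing z x y [:: x; y; z]) => //.
  by move=> w; rewrite !inE orbA orbC.
split.
  move=> one; split=> -[h1 h2].
  - exact: gluing_at_neq m (one _ _ (gx h1) (gy h2)).
  - apply: (gluing_at_neq x z y (min_triple_swap _ _ _ mz)).
    by rewrite (gluing_atC x z y); apply: one; [exact: gx|exact: gz].
  - apply: (gluing_at_neq y z x myz).
    rewrite (gluing_atC y z x) (gluing_atC z y x).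
    by apply: one; [exact: gy|exact: gz].
move=> [nxy nxz nyz] e f he hf.
have [e' [ee' ce]] := gluing_classification _ _ _ _ _ xyz mS he.
have [f' [ff' cf]] := gluing_classification _ _ _ _ _ xyz mS hf.
suff ef : e' = f' by rewrite -ef in ff'; exact: same_expression_swap ee' ff'.
by case: ce cf => -[-> g1] [] [-> g2] //; exfalso; tauto.
Qed.

Theorem theorem4p3 (a1 a2 a3 : nat) (S : set nat)
    (ha : a1 < a2 < a3)
    (hS : numerical_semigroup S)
    (hgen : minimal_generators [:: a1; a2; a3] S) :
  (at_most_one_gluing S -> Delta0 [:: a1; a2; a3] = [set 1; 2]) /\
  (~ at_most_one_gluing S -> Delta0 [:: a1; a2; a3] = [set 1]).
Proof.
have m := min_triple_of_generators _ _ _ _ ha hS hgen.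
have D2 : Delta0 [:: a1; a2; a3] 2 <-> at_most_one_gluing S.
  apply: iff_trans (Delta0_2 _ _ _ m) (iff_trans (skips2P _ _ _ m) _).
  exact: iff_sym (at_most_one_gluingP _ _ _ _ ha hS hgen).
have D1 := Delta0_1 _ _ _ m; have D12 d := Delta0_sub _ _ _ d m.
split=> one; apply/seteqP; split=> d /=.
- exact: D12.
- by case=> ->; [exact: D1 | exact/D2].
- move=> Dd; case: (D12 d Dd) => // d2; rewrite d2 in Dd.
  by case: one; apply/D2.
- by move=> ->.
Qed.
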